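(* Let $G$ be a finite graph (with no loops, no multiple edges and no isolated vertices) on vertex set $V$, and let $\Gamma^2_G$ be the Stanley--Reisner complex of the polarization of $I(G)^2$. Then the facets of $\Gamma^2_G$ are the maximal subsets of $V_{(1)}\cup V_{(2)}$ of the form $$W_{(1)}\cup A_{(1)}\cup Z_{(2)},$$ where $W$ is a maximal subset of $V$ in one of the following forms: - (independent type) $W=\emptyset$, $A\in\mathcal{A}(G)$, and $Z=V$; - (leaf type) $W=\{a,b\}$ where $G|_W$ is a leaf edge of $G$ with free vertex $a$, $A\in\mathcal{A}(G\setminus N_G[b])$, and $Z=V\setminus\{a\}$; - (star type) $W=\{a^1,\ldots,a^t,b\}$ where the induced subgraph $G|_W$ is a star centered at $b$, $A\in\mathcal{A}(G\setminus N_G[W])$, and $Z=V\setminus\{b\}$; - (triangle type) $W=\{a,b,c\}$ where $G|_W$ is a triangle, $A\in\mathcal{A}(G\setminus N_G[W])$, and $Z=V\setminus\{a,b,c\}$. In particular, if $\{a,b\}$ is an edge of $G$, then $\{a,b\}_{(1)}=\{a_1,b_1\}$ is an edge of $\Gamma^2_G$.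
   Context: Let $K$ be a field. For a finite graph $G$ with vertex set $V=V(G)$ and edge set $E(G)$, the edge ideal $I(G)\subseteq S=K[v : v\in V]$ is generated by the monomials $vw$ with $\{v,w\}\in E(G)$. The polarization of a monomial $m=\prod_{v} v^{e_v}$ is the squarefree monomial $\mathcal{P}(m)=\prod_{v} v_1v_2\cdots v_{e_v}$ in new variables $v_1,v_2,\ldots$, and the polarization $\mathcal{P}(I)$ of a monomial ideal $I$ is generated by the polarizations of the minimal monomial generators of $I$. The ideal $\mathcal{P}(I(G)^2)$ is regarded in the polynomial ring over $K$ in the variables $V_{(1)}\cup V_{(2)}$, where for a subset $U\subseteq V$ and $i\in\{1,2\}$ one writes $U_{(i)}=\{u_i : u\in U\}$. $\Gamma^2_G$ is the Stanley--Reisner complex of $\mathcal{P}(I(G)^2)$: it has vertex set $V_{(1)}\cup V_{(2)}$, and its faces are the subsets $\sigma\subseteq V_{(1)}\cup V_{(2)}$ such that the product of the variables in $\sigma$ is not in $\mathcal{P}(I(G)^2)$; facets are faces maximal under inclusion. An independent set of a graph is a set of pairwise non-adjacent vertices; $\mathcal{A}(H)$ denotes the set of all maximal independent sets of a graph $H$. $N_G(v)$ is the set of vertices adjacent to $v$, $N_G[v]=N_G(v)\cup\{v\}$, and $N_G[W]=\bigcup_{w\in W}N_G[w]$. $G|_U$ is the induced subgraph on $U$, and $G\setminus U=G|_{V\setminus U}$ (which may have isolated vertices). A star in $G$ is an induced subgraph consisting of edges $\{a^1,b\},\ldots,\{a^t,b\}$, and the vertex $b$ is its center. A leaf (free vertex)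 of $G$ is a vertex belonging to exactly one edge of $G$; that edge is called a leaf edge. *)

(* Defs.v *)
From mathcomp Require Import all_boot all_order all_algebra.
From mathcomp Require Import finmap monalg.

Set Implicit Arguments.
Unset Strict Implicit.
Unset Printing Implicit Defensive.

Import GRing.Theory.
Local Open Scope ring_scope.

(* Ideals, and simplicial complexes below, are membership predicates. *)
Definition ideal_span (R : comNzRingType) (gens : R -> Prop) (x : R) : Prop :=
  exists s : seq (R * R),
    (forall p, p \in s -> gens p.2) /\ x = \sum_(p <- s) p.1 * p.2.

Definition ideal_sqr (R : comNzRingType) (I : R -> Prop) : R -> Prop :=
  ideal_span (fun x => exists f g, [/\ I f, I g & x = f * g]).

Notation mpolyring K X := {malg K[{cmonom X}]}.

Definition mvar (K : fieldType) (X : choiceType) (x : X) : mpolyring K X :=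
  << ucm x >>.

(* K-algebra morphism K[X] -> K[Y] sending the variable x to the variable g x *)
Definition rename (K : fieldType) (X : finType) (Y : choiceType) (g : X -> Y)
    (f : mpolyring K X) : mpolyring K Y :=
  \sum_(m <- msupp f) f@_m *: \prod_(x : X) mvar K (g x) ^+ m x.

Definition mdivides (X : choiceType) (d m : {cmonom X}) : Prop :=
  forall x, (d x <= m x)%N.

Definition min_gen (K : fieldType) (X : choiceType)
    (I : mpolyring K X -> Prop) (m : {cmonom X}) : Prop :=
  I << m >> /\ forall d : {cmonom X}, I << d >> -> mdivides d m -> d = m.

(* The variable v_j, j >= 1, is encoded by the pair (v, j - 1). *)
Definition polar_monom (K : fieldType) (V : finType) (m : {cmonom V}) :
    mpolyring K (V * nat)%type :=
  \prod_(v : V) \prod_(j < m v) mvar K (v, val j).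

Definition polarization (K : fieldType) (V : finType)
    (I : mpolyring K V -> Prop) : mpolyring K (V * nat)%type -> Prop :=
  ideal_span (fun f => exists2 m, min_gen I m & f = polar_monom K m).

(* The polarization of I, regarded in the polynomial ring in the variables
   v_1, ..., v_k only: its contraction to that ring. *)
Definition polarization_in (K : fieldType) (V : finType) (k : nat)
    (I : mpolyring K V -> Prop) (f : mpolyring K (V * 'I_k)%type) : Prop :=
  polarization I (rename (fun x : V * 'I_k => (x.1, val x.2)) f).

Definition stanley_reisner (K : fieldType) (X : finType)
    (J : mpolyring K X -> Prop) (s : {set X}) : Prop :=
  ~ J (\prod_(x in s) mvar K x).

Definition maximal (X : finType) (P : {set X} -> Prop) (s : {set X}) : Prop :=
  P s /\ forall t : {set X}, P t -> s \subset t -> t = s.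

Definition facet (X : finType) (face : {set X} -> Prop) : {set X} -> Prop :=
  maximal face.

Definition complex_edge (X : finType) (face : {set X} -> Prop) (s : {set X}) :
  Prop := face s /\ #|s| = 2%N.

(* A simple graph is a symmetric irreflexive relation on a finite type. *)

Section Graph.

Variables (V : finType) (e : rel V).
Implicit Types (a b c v w x y : V) (A B U W Z : {set V}).

Definition edge_set : {set {set V}} :=
  [set [set p.1; p.2] | p : V * V & e p.1 p.2].

Definition nbrs v : {set V} := [set w | e v w].
Definition cl_nbrs v : {set V} := v |: nbrs v.
Definition cl_nbrs_set W : {set V} := \bigcup_(w in W) cl_nbrs w.

Definition independent A : bool := [forall x in A, forall y in A, ~~ e x y].

(* A is a maximal independent set of the induced subgraph on U *)
Definition max_indep U A : Prop :=
  maximal (fun B => (B \subset U) && independent B) A.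

Definition free_vertex a : Prop := #|[set E in edge_set | a \in E]| = 1%N.

(* W = {a^1, ..., a^t, b} induces a star with center b, where t >= 1 *)
Definition induced_star W b : Prop :=
  exists B, [/\ B != set0, b \notin B, W = b |: B,
                {in B, forall a, [set a; b] \in edge_set} & independent B].

Definition independent_type W A Z : Prop :=
  [/\ W = set0, max_indep setT A & Z = setT].

Definition leaf_type W A Z : Prop :=
  exists a b, [/\ W = [set a; b], W \in edge_set, free_vertex a,
                  max_indep (~: cl_nbrs b) A & Z = ~: [set a]].

Definition star_type W A Z : Prop :=
  exists b, [/\ induced_star W b,
                max_indep (~: cl_nbrs_set W) A & Z = ~: [set b]].

Definition triangle_type W A Z : Prop :=
  exists a b c, [/\ W = [set a; b; c], [&& e a b, e b c & e a c],
                    max_indep (~: cl_nbrs_set W) A & Z = ~: [set a; b; c]].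

Definition facet_type W A Z : Prop :=
  [\/ independent_type W A Z, leaf_type W A Z, star_type W A Z
    | triangle_type W A Z].

Definition copy1 U : {set V * 'I_2} := [set (u, ord0) | u in U].
Definition copy2 U : {set V * 'I_2} := [set (u, ord_max) | u in U].

(* W is maximal relative to A and Z, where Z fixes the center of a star.
   Maximality among all the sets W of a given type would be too strong: in the
   path a-b-c-d, the facet {a,b,d}_(1) U {a,c,d}_(2) has W = {a,b}, centered at
   b, although {a,b,c} is a larger star centered at b. *)
Definition listed_form (F : {set V * 'I_2}) : Prop :=
  exists W A Z, maximal (fun W' => facet_type W' A Z) W /\
                F = copy1 W :|: copy1 A :|: copy2 Z.

End Graph.

Definition edge_ideal (K : fieldType) (V : finType) (e : rel V) :
    mpolyring K V -> Prop :=
  ideal_span (fun f => exists v w, [set v; w] \in edge_set e /\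
                                   f = mvar K v * mvar K w).

Definition Gamma2 (K : fieldType) (V : finType) (e : rel V) :
    {set V * 'I_2} -> Prop :=
  stanley_reisner (polarization_in (ideal_sqr (@edge_ideal K V e))).

(* Main.v *)
Require Import Defs.
From mathcomp Require Import all_boot all_order all_algebra.
From mathcomp Require Import finmap monalg.

(* A squarefree monomial X_(1) Y_(2) lies outside the polarization of I(G)^2 iff
   any two edges of G inside X, possibly equal, share a vertex not in Y. So the
   edges inside X pairwise meet: there are none, or they form a triangle, or
   they form a star. In a triangle each vertex is shared by two of the edges and
   hence avoids Y; in a star some common vertex of all the edges avoids Y. The
   remaining vertices of X are independent and not adjacent to the edges, and
   they extend to a maximal independent set A. Hence the sets of the listed types
   are faces and every face lies in one of them. Maximality of W given A and Z is
   automatic at a facet because W and A are disjoint for every type. *)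

Set Implicit Arguments.
Unset Strict Implicit.
Unset Printing Implicit Defensive.

Import GRing.Theory.
Local Open Scope ring_scope.

(** * Divisibility of monomials, and monomials in ideals *)

Section Monomials.

Variables (K : fieldType) (X : choiceType).
Implicit Types (d m : {cmonom X}) (f g : mpolyring K X).

Lemma mdivides_trans d2 d1 d3 :
  mdivides d1 d2 -> mdivides d2 d3 -> mdivides d1 d3.
Proof. by move=> h h' x; apply: leq_trans (h x) (h' x). Qed.

Lemma mdivides_mul d1 d2 m1 m2 :
  mdivides d1 m1 -> mdivides d2 m2 -> mdivides (mmul d1 d2) (mmul m1 m2).
Proof. by move=> h1 h2 x; rewrite !cmM leq_add. Qed.

Lemma mdivides_mull d m : mdivides d (mmul m d).
Proof. by move=> x; rewrite cmM leq_addl. Qed.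

Lemma divcmK d m : mdivides d m -> mmul (divcm m d) d = m.
Proof. by move=> h; apply/eqP/cmP => x; rewrite cmM divcmE subnK. Qed.

(** The quotient has degree 0, so it is the unit monomial. *)
Lemma mdivides_mdeg_eq d m : mdivides d m -> (mdeg m <= mdeg d)%N -> d = m.
Proof.
move=> dm; rewrite -{1}(divcmK dm) mdegM -{2}[mdeg d]add0n leq_add2r leqn0.
by rewrite mdeg_eq0 -[in RHS](divcmK dm) => /eqP->; rewrite mul1m.
Qed.

Lemma monomM m1 m2 : << m1 >> * << m2 >> = << mmul m1 m2 >> :> mpolyring K X.
Proof. by rewrite malgM_def fgmulUU mulr1. Qed.

Lemma monom_prod (I : Type) (r : seq I) (P : pred I) (F : I -> {cmonom X}) :
  \prod_(i <- r | P i) (<< F i >> : mpolyring K X) =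
  << \big[mmul/mone]_(i <- r | P i) F i >>.
Proof.
symmetry; apply: (big_morph (fun m => << m >> : mpolyring K X)) => // m1 m2.
by rewrite monomM.
Qed.

Lemma cm_prod (I : Type) (r : seq I) (P : pred I) (F : I -> {cmonom X}) x :
  (\big[mmul/mone]_(i <- r | P i) F i) x = (\sum_(i <- r | P i) F i x)%N.
Proof.
by apply: (big_morph (fun m : {cmonom X} => m x)) => [m1 m2|]; rewrite ?cmM ?cm1.
Qed.

Lemma ideal_span_mul (gens : mpolyring K X -> Prop) f g :
  gens g -> ideal_span gens (f * g).
Proof.
move=> gg; exists [:: (f, g)]; split; last by rewrite big_seq1.
by move=> p; rewrite inE => /eqP->.
Qed.

Lemma ideal_span_gen (gens : mpolyring K X -> Prop) g :
  gens g -> ideal_span gens g.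
Proof. by move=> gg; rewrite -[g]mul1r; apply: ideal_span_mul. Qed.

(** When [P] is closed under multiples, this is membership in the monomial ideal spanned by the
    monomials satisfying [P]. *)
Definition supported (P : {cmonom X} -> Prop) f :=
  forall m, m \in msupp f -> P m.

Lemma supported_monom (P : {cmonom X} -> Prop) m : supported P << m >> <-> P m.
Proof.
split=> [|Pm m']; first by apply; rewrite msuppU1 in_fset1.
by rewrite msuppU1 in_fset1 => /eqP->.
Qed.

Lemma supported_mul (P Q R : {cmonom X} -> Prop) f g :
  (forall m1 m2, P m1 -> Q m2 -> R (mmul m1 m2)) ->
  supported P f -> supported Q g -> supported R (f * g).
Proof.
by move=> PQR Pf Qg m /msuppM_le[m1 [m2 [/Pf P1 /Qg Q2 ->]]]; apply: PQR.
Qed.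

(** Polynomials supported on an upward closed [P] form an ideal, so testing the generators is
    enough. *)
Lemma supported_ideal_span (P : {cmonom X} -> Prop) gens f :
  (forall d m, mdivides d m -> P d -> P m) ->
  (forall g, gens g -> supported P g) -> ideal_span gens f -> supported P f.
Proof.
move=> Pup gensP [s [sP ->]]; rewrite big_seq.
elim/big_ind: _ => [m|f1 f2 P1 P2 m|p /sP/gensP Pg]; first by rewrite msupp0.
  by move=> /(fsubsetP (msuppD_le f1 f2)); rewrite in_fsetU => /orP[/P1|/P2].
apply: (@supported_mul (fun _ => True) P) => // m1 m2 _.
by apply: Pup; apply: mdivides_mull.
Qed.

(** The generators may be arbitrary polynomials, which suits [ideal_sqr]: its generators are
    products of any two elements. *)
Lemma ideal_span_monom (P : {cmonom X} -> Prop) gens m :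
  (forall d m', mdivides d m' -> P d -> P m') ->
  (forall g, gens g -> supported P g) -> ideal_span gens << m >> -> P m.
Proof.
move=> Pup gensP /(supported_ideal_span Pup gensP) Pm.
exact/supported_monom/Pm.
Qed.

End Monomials.

(** * Renaming the variables of a squarefree monomial *)

Section Rename.

Variables (K : fieldType) (X : finType) (Y : choiceType) (g : X -> Y).

(** The product is a single monomial with coefficient 1, so the sum in [rename] has one term, and
    its exponents are 0 or 1. *)
Lemma rename_squarefree (s : {set X}) :
  rename g (\prod_(x in s) mvar K x) = \prod_(x in s) mvar K (g x).
Proof.
rewrite monom_prod /rename msuppU1 big_seq_fset1 mcoeffUU scale1r.
rewrite [RHS]big_mkcond; apply: eq_bigr => x _; rewrite cm_prod.
have -> : (\sum_(i in s) ucm i x = (x \in s))%N.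
  rewrite big_mkcond (bigD1 x) //= ucmE eqxx big1 => [|y /negPf yx].
    by case: (x \in s).
  by rewrite ucmE yx; case: ifP.
by case: ifP.
Qed.

End Rename.

(** * Faces of the Stanley-Reisner complex of a polarization *)

Section Polarization.

Variables (K : fieldType) (V : finType).

Definition polar_cmonom (m : {cmonom V}) : {cmonom (V * nat)%type} :=
  \big[mmul/mone]_(v : V) \big[mmul/mone]_(j < m v) ucm (v, val j).

Lemma polar_monomE m : polar_monom K m = << polar_cmonom m >>.
Proof.
rewrite /polar_monom -monom_prod.
by apply: eq_bigr => v _; rewrite -monom_prod.
Qed.

Lemma polar_cmonomE m v i : polar_cmonom m (v, i) = (i < m v)%N.
Proof.
rewrite cm_prod (bigD1 v) //= [X in (_ + X)%N]big1 => [|w /negPf wv].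
  rewrite addn0 cm_prod; case: ltnP => [lt_i|le_i].
    rewrite (bigD1 (Ordinal lt_i)) //= ucmE eqxx big1 // => j.
    by rewrite ucmE xpair_eqE eqxx /= => /negPf ji; rewrite [_ == i]ji.
  rewrite big1 // => j _; rewrite ucmE xpair_eqE eqxx /=.
  by rewrite ltn_eqF // (leq_trans (ltn_ord j)).
by rewrite cm_prod big1 // => j _; rewrite ucmE xpair_eqE wv.
Qed.

(** A monomial lies in the polarization iff some polarized minimal generator divides it; for a
    squarefree monomial this is a condition on its support. Asking for [j : 'I_k] rules out
    generators with an exponent above [k]. *)
Lemma stanley_reisner_polarization k (I : mpolyring K V -> Prop)
    (s : {set V * 'I_k}) :
  stanley_reisner (polarization_in I) s <->
  ~ exists2 m, min_gen I m &
    forall v i, (i < m v)%N -> exists2 j : 'I_k, i = j & (v, j) \in s.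
Proof.
rewrite /stanley_reisner /polarization_in rename_squarefree monom_prod.
set M := \big[_/_]_(_ in s) _.
have ME v i : (0 < M (v, i))%N <-> exists2 j : 'I_k, i = j & (v, j) \in s.
  rewrite cm_prod; split=> [|[j -> sj]].
    rewrite lt0n sum_nat_eq0 negb_forall => /existsP[[w j]].
    rewrite negb_imply ucmE eqb0 negbK xpair_eqE => /and3P[sj /eqP<- /eqP<-].
    by exists j.
  by rewrite (bigD1 (v, j)) //= ucmE eqxx.
suff <- : polarization I << M >> <-> exists2 m, min_gen I m &
  forall v i, (i < m v)%N -> exists2 j : 'I_k, i = j & (v, j) \in s by [].
split=> [|[m Im ms]].
  move=> polM.
  suff [m Im mM] : exists2 m, min_gen I m & mdivides (polar_cmonom m) M.
    exists m => // v i im; apply/ME.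
    by apply: leq_trans (mM (v, i)); rewrite polar_cmonomE im.
  move: polM; pose P M' := exists2 m, min_gen I m & mdivides (polar_cmonom m) M'.
  apply: (ideal_span_monom (P := P)) => [d M' dM [m Im md]|_ [m Im ->]].
    by exists m => //; apply: mdivides_trans md dM.
  by rewrite polar_monomE; apply/supported_monom; exists m.
have mM : mdivides (polar_cmonom m) M.
  move=> [v i]; rewrite polar_cmonomE; case: ltnP => // im.
  by apply/ME/ms.
rewrite -(divcmK mM) -monomM -polar_monomE.
by apply: ideal_span_mul; exists m.
Qed.

End Polarization.

(** * Generators of the squared edge ideal, and the faces of [Gamma2] *)

Section GraphIdeal.

Variables (K : fieldType) (V : finType) (e : rel V).
Hypotheses (e_sym : symmetric e) (e_irr : irreflexive e).
Implicit Types (a b c d v w x y : V) (A B U W X Y Z : {set V}).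
Implicit Types (s t : {set V * 'I_2}).

Lemma edge_neq x y : e x y -> x != y.
Proof. by apply: contraTneq => ->; rewrite e_irr. Qed.

Lemma edge_setE v w : ([set v; w] \in edge_set e) = e v w.
Proof.
apply/imsetP/idP => [[[x y]]|evw]; last by exists (v, w) => //; rewrite inE.
rewrite inE /= => exy vw.
have : v \in [set x; y] by rewrite -vw !inE eqxx.
have : w \in [set x; y] by rewrite -vw !inE eqxx orbT.
have : x \in [set v; w] by rewrite vw !inE eqxx.
have : y \in [set v; w] by rewrite vw !inE eqxx orbT.
have /negPf xy := edge_neq exy.
rewrite !inE => /orP[]/eqP yE /orP[]/eqP xE; subst x y.
- by rewrite eqxx in xy.
- by rewrite e_sym.
- by [].
- by rewrite eqxx in xy.
Qed.

(** An edge contributes at most 1 to the exponent of [v], so exponent 2 in a product of two edges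
    means that [v] lies on both. *)
Lemma addb_set2 x y v :
  x != y -> ((x == v) + (y == v) = (v \in [set x; y]))%N.
Proof.
move=> xy; rewrite !inE !(eq_sym v); have [<-|//] := eqVneq x v.
by rewrite eq_sym (negPf xy).
Qed.

Definition edge_monom a b : {cmonom V} := mmul (ucm a) (ucm b).

Definition sqr_monom a b c d := mmul (edge_monom a b) (edge_monom c d).

Lemma sqr_monomE a b c d v :
  sqr_monom a b c d v = ((a == v) + (b == v) + ((c == v) + (d == v)))%N.
Proof. by rewrite !cmM !ucmE. Qed.

Lemma edge_ideal_supp (f : mpolyring K V) : edge_ideal e f ->
  supported (fun m => exists a b, e a b /\ mdivides (edge_monom a b) m) f.
Proof.
apply: supported_ideal_span => [d m dm [a [b [eab ad]]]|g [a [b [eab ->]]]].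
  by exists a, b; split=> //; apply: mdivides_trans ad dm.
rewrite edge_setE in eab.
by rewrite monomM; apply/supported_monom; exists a, b; split.
Qed.

Lemma edge_ideal_sqr_monom m : ideal_sqr (@edge_ideal K V e) << m >> <->
  exists a b c d, [/\ e a b, e c d & mdivides (sqr_monom a b c d) m].
Proof.
split=> [|[a [b [c [d [eab ecd /divcmK<-]]]]]].
  pose P m := exists a b c d, [/\ e a b, e c d & mdivides (sqr_monom a b c d) m].
  apply: (ideal_span_monom (P := P)) => [m1 m2 m12|_ [f [g [If Ig ->]]]].
    move=> [a [b [c [d [eab ecd am]]]]]; exists a, b, c, d; split=> //.
    exact: mdivides_trans am m12.
  apply: supported_mul (edge_ideal_supp If) (edge_ideal_supp Ig) => m1 m2.
  move=> [a [b [eab abm]]] [c [d [ecd cdm]]]; exists a, b, c, d.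
  by split=> //; apply: mdivides_mul.
rewrite -monomM; apply: ideal_span_mul.
have I x y : e x y -> edge_ideal e (<< edge_monom x y >> : mpolyring K V).
  move=> exy; apply: ideal_span_gen; exists x, y.
  by rewrite edge_setE monomM.
by exists << edge_monom a b >>, << edge_monom c d >>; rewrite monomM; split; auto.
Qed.

(** Every monomial of the ideal has degree at least 4, so one dividing this product of degree 4
    equals it. *)
Lemma edge_ideal_sqr_min_gen a b c d : e a b -> e c d ->
  min_gen (ideal_sqr (@edge_ideal K V e)) (sqr_monom a b c d).
Proof.
move=> eab ecd; split=> [|m /edge_ideal_sqr_monom[a' [b' [c' [d' [_ _ dm]]]]] md].
  by apply/edge_ideal_sqr_monom; exists a, b, c, d; split.
apply: mdivides_mdeg_eq md _; rewrite -[in leqRHS](divcmK dm).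
by rewrite !mdegM !mdegU leq_addl.
Qed.

Definition layer (i : 'I_2) s : {set V} := [set v | (v, i) \in s].

(** The two edges may coincide, so each edge inside [X] has an end outside [Y]. The condition is
    boolean so that maximal faces can be found with [maxset]. *)
Definition edges_meet X Y : bool :=
  [forall a in X, forall b in X, forall c in X, forall d in X,
    e a b && e c d ==>
    [exists v in ~: Y, (v \in [set a; b]) && (v \in [set c; d])]].

Lemma edges_meetP X Y : reflect
  (forall a b c d, a \in X -> b \in X -> c \in X -> d \in X ->
     e a b -> e c d ->
     exists v, [/\ v \notin Y, v \in [set a; b] & v \in [set c; d]])
  (edges_meet X Y).
Proof.
apply: (iffP forall_inP) => [H a b c d aX bX cX dX eab ecd|H a aX].
  move/(_ a aX)/forall_inP/(_ b bX)/forall_inP/(_ c cX)/forall_inP: H.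
  move=> /(_ d dX)/implyP; rewrite eab ecd => /(_ isT)/exists_inP[v].
  by rewrite inE => vY /andP[]; exists v.
apply/forall_inP => b bX; apply/forall_inP => c cX; apply/forall_inP => d dX.
apply/implyP => /andP[eab ecd].
have [v [vY vab vcd]] := H a b c d aX bX cX dX eab ecd.
by apply/exists_inP; exists v; rewrite ?inE // -!in_set2 vab vcd.
Qed.

(** The polarized product of two edges divides the monomial of [s] iff all their ends lie in layer
    [ord0] and all their common vertices in layer [ord_max]. *)
Lemma Gamma2E s :
  Gamma2 K e s <-> edges_meet (layer ord0 s) (layer ord_max s).
Proof.
have [_ H] := stanley_reisner_polarization (ideal_sqr (@edge_ideal K V e)) s.
have [H' _] := stanley_reisner_polarization (ideal_sqr (@edge_ideal K V e)) s.
rewrite /Gamma2; split=> [/H' {H H'} nogen|/edges_meetP meet].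
  apply/edges_meetP => a b c d; rewrite !inE => a0 b0 c0 d0 eab ecd.
  have [/existsP[v /and3P[]]|] := boolP [exists v,
      [&& v \notin layer ord_max s, v \in [set a; b] & v \in [set c; d]]].
    by exists v.
  (* All common vertices lie in the second layer, so the polarized product of these two edges
     divides the monomial of [s]. *)
  rewrite negb_exists => /forallP nov; case: nogen.
  exists (sqr_monom a b c d); first exact: edge_ideal_sqr_min_gen.
  move=> v i.
  have v0 : (0 < sqr_monom a b c d v)%N -> (v, ord0) \in s.
    by rewrite sqr_monomE; do 4![case: eqP => [<- //|_]].
  rewrite sqr_monomE !addb_set2 ?edge_neq // in v0 *.
  (* Index 0 needs [v] on one of the edges, index 1 needs it on both, and no exponent exceeds 2. *)
  case: i => [/v0|i]; first by exists ord0.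
  have := nov v; rewrite inE negb_and negbK; case: (v \in [set a; b]) => /=; last first.
    by case: (v \in _).
  case: (v \in [set c; d]); rewrite ?orbF // => v1.
  by case: i => // _; exists ord_max.
apply: H => -[m [/edge_ideal_sqr_monom[a [b [c [d [eab ecd abcd]]]]] _] ms].
have {}ms v i : (i < sqr_monom a b c d v)%N ->
    exists2 j : 'I_2, i = j & (v, j) \in s.
  by move=> /leq_trans/(_ (abcd v)); apply: ms.
have s0 v : (0 < sqr_monom a b c d v)%N -> v \in layer ord0 s.
  by move=> /ms[j j0]; rewrite inE (_ : ord0 = j) //; apply: val_inj.
have [||||v [v1 vab vcd]] := meet a b c d _ _ _ _ eab ecd.
1-4: by apply: s0; rewrite sqr_monomE eqxx ?orbT ?addnS ?addSn.
rewrite !inE in v1 vab vcd; case/negP: v1.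
(* A common vertex has exponent 2, so its second copy, of index 1, is in [s]. *)
have [|j j1 vj] := ms v 1%N; last by rewrite (_ : ord_max = j) //; apply: val_inj.
rewrite sqr_monomE !(eq_sym _ v).
by case/orP: vab => ->; case/orP: vcd => ->; rewrite ?addnS ?addSn.
Qed.

End GraphIdeal.

(** * The listed sets, and independent sets off a neighbourhood *)

Section Facets.

Variables (V : finType) (e : rel V).
Hypotheses (e_sym : symmetric e) (e_irr : irreflexive e).
Implicit Types (a b c d u v w x y : V) (A B U W X Y Z : {set V}).
Implicit Types (s t : {set V * 'I_2}).

Definition listed_set W A Z : {set V * 'I_2} :=
  copy1 W :|: copy1 A :|: copy2 Z.

Lemma in_listed_set0 W A Z v :
  ((v, ord0) \in listed_set W A Z) = (v \in W) || (v \in A).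
Proof.
have in_copy U i : ((v, ord0) \in [set (u, i) | u in U]) = (i == ord0) && (v \in U).
  by apply/imsetP/andP => [[u uU [-> <-]]|[/eqP-> vU]]; [|exists v].
by rewrite !inE !in_copy orbF.
Qed.

Lemma in_listed_set1 W A Z v : ((v, ord_max) \in listed_set W A Z) = (v \in Z).
Proof.
have in_copy U i :
    ((v, ord_max) \in [set (u, i) | u in U]) = (i == ord_max) && (v \in U).
  by apply/imsetP/andP => [[u uU [-> <-]]|[/eqP-> vU]]; [|exists v].
by rewrite !inE !in_copy.
Qed.

Lemma sub_listed_set s W A Z :
  (s \subset listed_set W A Z) =
  (layer ord0 s \subset W :|: A) && (layer ord_max s \subset Z).
Proof.
apply/subsetP/andP => [H|[/subsetP H0 /subsetP H1] [v i]].
  by split; apply/subsetP => v; rewrite inE => /H;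
    rewrite ?in_listed_set0 ?in_listed_set1 ?inE.
have [->|->] : i = ord0 \/ i = ord_max.
  by case: i => -[|[|//]] i2; [left|right]; apply: val_inj.
  by rewrite in_listed_set0 => vs; have := H0 v; rewrite !inE; apply.
by rewrite in_listed_set1 => vs; have := H1 v; rewrite !inE; apply.
Qed.

Lemma edges_meet_sub X X' Y Y' :
  X \subset X' -> Y \subset Y' -> edges_meet e X' Y' -> edges_meet e X Y.
Proof.
move=> /subsetP XX /subsetP YY /edges_meetP H.
apply/edges_meetP => a b c d aX bX cX dX eab ecd.
have [v [vY vab vcd]] :=
  H a b c d (XX _ aX) (XX _ bX) (XX _ cX) (XX _ dX) eab ecd.
by exists v; split=> //; apply: contra (YY v) vY.
Qed.

Lemma independentP A :
  reflect (forall x y, x \in A -> y \in A -> ~~ e x y) (independent e A).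
Proof.
apply: (iffP forall_inP) => [H x y xA yA|H x xA].
  by have /forall_inP := H x xA; apply.
by apply/forall_inP => y; apply: H.
Qed.

Lemma cl_nbrs_setP W x :
  reflect (x \in W \/ exists2 w, w \in W & e w x) (x \in cl_nbrs_set e W).
Proof.
apply: (iffP bigcupP) => [[w wW]|[xW|[w wW ewx]]].
- by rewrite !inE => /orP[/eqP->|ewx]; [left|right; exists w].
- by exists x; rewrite ?inE ?eqxx.
- by exists w; rewrite // !inE ewx orbT.
Qed.

Lemma max_indep_ext U A : A \subset U -> independent e A ->
  exists2 B, max_indep e U B & A \subset B.
Proof.
move=> AU indA.
have [|B /maxsetP[PB maxB] AB] :=
  @maxset_exists V (fun B => (B \subset U) && independent e B) A.
  by rewrite AU.
by exists B => //; split.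
Qed.

(* A free vertex has a single neighbour, so a leaf {a, b} is a star with
   center a, and N[{a, b}] = N[b]. *)
Lemma leaf_type_star W A Z : leaf_type e W A Z -> star_type e W A Z.
Proof.
move=> [a [b [-> eab free_a maxA ->]]].
rewrite edge_setE // in eab; have ab := edge_neq e_irr eab.
have nbr_a x : e a x -> x = b.
  move=> eax; move/eqP/cards1P: free_a => [E].
  move=> /setP EP; apply/eqP; apply: contraTT (eab) => /negPf xb.
  have := EP [set a; b]; have := EP [set a; x].
  rewrite !inE !edge_setE // eab eax !eqxx /= => /esym/eqP <- /esym/eqP/setP.
  by move/(_ x); rewrite !inE xb eqxx orbT orbF => /eqP xa; rewrite xa e_irr in eax.
exists a; split=> //.
  exists [set b]; split; rewrite ?inE //.
  - by apply/set0Pn; exists b; rewrite inE.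
  - by move=> x; rewrite inE => /eqP->; rewrite edge_setE // e_sym.
  - by apply/independentP => x y; rewrite !inE => /eqP-> /eqP->; rewrite e_irr.
suff -> : cl_nbrs_set e [set a; b] = cl_nbrs e b by [].
apply/setP => x; apply/cl_nbrs_setP/idP => [[|[w]]|]; rewrite !inE.
- by case/orP=> /eqP->; rewrite ?eqxx // e_sym eab orbT.
- by case/orP=> /eqP-> => [/nbr_a->|->]; rewrite ?eqxx ?orbT.
- case/orP=> [/eqP->|ebx]; first by left; rewrite eqxx orbT.
  by right; exists b; rewrite // !inE eqxx orbT.
Qed.

(** * The listed sets are faces *)

Lemma max_indep_edges W A x y : max_indep e (~: cl_nbrs_set e W) A ->
  x \in W :|: A -> y \in W :|: A -> e x y -> x \in W.
Proof.
move=> [/andP[/subsetP AU /independentP indA] _] + yWA exy.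
(* An edge between [A] and [W] is excluded because [A] avoids the closed neighbourhood of [W], an
   edge inside [A] by independence. *)
rewrite inE => /orP[//|xA]; move: yWA; rewrite inE => /orP[yW|yA].
  have := AU x xA; rewrite inE => /cl_nbrs_setP[].
  by right; exists y; rewrite // e_sym.
by have := indA x y xA yA; rewrite exy.
Qed.

(** In a star every edge passes through the center, which [Z] omits; in a triangle any two edges
    share a vertex, and [Z] omits all three vertices. *)
Lemma edges_meet_facet_type W A Z :
  facet_type e W A Z -> edges_meet e (W :|: A) Z.
Proof.
have star : star_type e W A Z -> edges_meet e (W :|: A) Z.
  move=> [b [[B [_ _ WE _ /independentP indB]] maxA ->]].
  have center x y : x \in W :|: A -> y \in W :|: A -> e x y -> b \in [set x; y].
    move=> xX yX exy; have xW := max_indep_edges maxA xX yX exy.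
    have yW : y \in W by apply: max_indep_edges maxA yX xX _; rewrite e_sym.
    move: xW yW; rewrite WE !inE !(eq_sym b).
    case: eqP => //= _ xB; case: eqP => //= _ yB.
    by have := indB x y xB yB; rewrite exy.
  apply/edges_meetP => x y z t xX yX zX tX exy ezt; exists b.
  by rewrite !inE eqxx -!in_set2 !center.
case=> [[-> [/andP[_ /independentP indA] _] _]|/leaf_type_star|//|].
- apply/edges_meetP => x y z t; rewrite !inE /= => xA yA _ _ exy.
  by have := indA x y xA yA; rewrite exy.
- exact: star.
move=> [a [b [c [WE /and3P[eab ebc eac] maxA ->]]]].
apply/edges_meetP => x y z t xX yX zX tX exy ezt.
have xW := max_indep_edges maxA xX yX exy.
have zW := max_indep_edges maxA zX tX ezt.
have yW : y \in W by apply: max_indep_edges maxA yX xX _; rewrite e_sym.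
have tW : t \in W by apply: max_indep_edges maxA tX zX _; rewrite e_sym.
(* Pigeonhole: two edges inside a set of three vertices share an end. Assignments that create a loop
   are refuted by [e_irr]. *)
have : [|| x == z, x == t, y == z | y == t].
  move: xW yW zW tW; rewrite WE !inE -!orbA.
  do 4![case/or3P=> /eqP ?]; subst; rewrite ?eqxx ?orbT //;
    by move: exy ezt; rewrite ?e_irr.
by case/or4P=> /eqP E; [exists z|exists t|exists z|exists t];
  rewrite -WE E !inE ?eqxx ?orbT ?negbK.
Qed.

(** [W] lies in its own closed neighbourhood, which [A] avoids. At a facet this yields the
    maximality of [W] for given [A] and [Z]. *)
Lemma facet_type_disjoint W A Z v :
  facet_type e W A Z -> v \in W -> v \notin A.
Proof.
have maxW : max_indep e (~: cl_nbrs_set e W) A -> v \in W -> v \notin A.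
  move=> [/andP[/subsetP AU _] _] vW; apply/negP => /AU; rewrite inE.
  by case/cl_nbrs_setP; left.
case=> [[-> _ _]|/leaf_type_star[b [_ ? _]]|[b [_ ? _]]|[a [b [c [_ _ ? _]]]]].
- by rewrite inE.
all: exact: maxW.
Qed.

(** * Every face lies in a listed set *)

Lemma max_indep_cover X W : W \subset X ->
  (forall x y, x \in X -> y \in X -> e x y -> x \in W) ->
  exists2 A, max_indep e (~: cl_nbrs_set e W) A & X \subset W :|: A.
Proof.
move=> /subsetP WX edgeW.
(* Every edge inside [X] has both ends in [W], so the rest of [X] is independent and not adjacent to
   [W]. *)
have [|| A maxA XA] := @max_indep_ext (~: cl_nbrs_set e W) (X :\: W).
- apply/subsetP => x; rewrite !inE => /andP[xW xX].
  apply/cl_nbrs_setP => -[|[w wW ewx]]; first exact/negP.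
  by case/negP: xW; apply: (edgeW x w) => //; [apply: WX|rewrite e_sym].
- apply/independentP => x y; rewrite !inE => /andP[/negP xW xX] /andP[_ yX].
  by apply/negP => exy; apply: xW; apply: edgeW exy.
exists A => //; apply/subsetP => x xX; have [xW|xW] := boolP (x \in W).
  by rewrite inE xW.
by rewrite inE (subsetP XA) ?orbT // inE xW.
Qed.

(** The center is an end of the given edge [u v]: if neither end qualified, two further edges at [u]
    and at [v] would have to meet and close a triangle. *)
Lemma edges_meet_center X Y u v :
  edges_meet e X Y ->
  (forall a b c, a \in X -> b \in X -> c \in X -> e a b -> e b c -> ~~ e a c) ->
  u \in X -> v \in X -> e u v ->
  exists b, [/\ b \in X, b \notin Y, exists2 a, a \in X & e b a &
    forall x y, x \in X -> y \in X -> e x y -> b \in [set x; y]].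
Proof.
move=> /edges_meetP meet notri uX vX euv.
have evu : e v u by rewrite e_sym.
pose P b := [forall x in X, forall y in X, e x y ==> (b \in [set x; y])].
have PP b : P b -> forall x y, x \in X -> y \in X -> e x y -> b \in [set x; y].
  move=> /forall_inP H x y xX yX exy.
  by have /forall_inP/(_ y yX)/implyP/(_ exy) := H x xX.
(* An edge missing [b] must meet the edge [a b] in [a]; these two edges share only [a], so [a]
   avoids [Y]. *)
have second a b : a \in X -> b \in X -> e a b ->
    P b \/ exists y, [/\ y \in X, e a y, y != b & a \notin Y].
  move=> aX bX eab; have [|notP] := boolP (P b); [by left|right].
  have {}second y : y \in X -> e a y -> y != b ->
      exists y, [/\ y \in X, e a y, y != b & a \notin Y].
    move=> yX eay yb; exists y; split=> //.
    have [w [wY]] := meet a b a y aX bX aX yX eab eay.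
    rewrite !inE => /orP[/eqP<- //|/eqP wb] /orP[/eqP<- //|/eqP wy].
    by rewrite -wy wb eqxx in yb.
  have /forall_inPn[x xX /forall_inPn[y yX]] := notP.
  rewrite negb_imply !inE negb_or => /and3P[exy bx yb].
  have [w [_]] := meet a b x y aX bX xX yX eab exy.
  rewrite !inE => /orP[]/eqP-> /orP[]/eqP E; subst.
  - by apply: (second y); rewrite // eq_sym.
  - by apply: (second x); rewrite 1?e_sym // eq_sym.
  - by rewrite eqxx in bx.
  - by rewrite eqxx in yb.
have [Pv|[y [yX euy yv uY]]] := second u v uX vX euv.
  have [Pu|[x [xX evx xu vY]]] := second v u vX uX evu.
    (* Both ends lie on every edge; comparing the edge with itself gives an end outside [Y]. *)
    have [w [wY]] := meet u v u v uX vX uX vX euv euv.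
    rewrite !inE => /orP[]/eqP E _; subst w.
      by exists u; split; [| |exists v|apply: PP].
    by exists v; split; [| |exists u|apply: PP].
  by exists v; split; [| |exists u|apply: PP].
have [Pu|[x [xX evx xu vY]]] := second v u vX uX evu.
  by exists u; split; [| |exists v|apply: PP].
(* The edges [u y] and [v x] can only meet in [x = y], which gives a triangle. *)
have [w [_]] := meet u y v x uX yX vX xX euy evx.
rewrite !inE => /orP[]/eqP-> /orP[]/eqP E; subst.
- by rewrite e_irr in euv.
- by rewrite eqxx in xu.
- by rewrite eqxx in yv.
- by have := notri u v x uX vX xX euv evx; rewrite euy.
Qed.

Lemma edges_meet_sub_facet_type X Y : edges_meet e X Y ->
  exists W A Z, [/\ facet_type e W A Z, X \subset W :|: A & Y \subset Z].
Proof.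
move=> meet; have /edges_meetP meetP := meet.
have [/existsP[[[a b] c] /= /and5P[aX bX cX eab /andP[ebc eac]]]|notri] :=
  boolP [exists p : V * V * V, [&& p.1.1 \in X, p.1.2 \in X, p.2 \in X,
    e p.1.1 p.1.2 & e p.1.2 p.2 && e p.1.1 p.2]].
  have /negPf ab := edge_neq e_irr eab; have /negPf ac := edge_neq e_irr eac.
  have /negPf bc := edge_neq e_irr ebc.
  have [||A maxA XA] := @max_indep_cover X [set a; b; c].
  - by apply/subsetP => x; rewrite !inE -orbA => /or3P[]/eqP->.
  (* If [x] were outside the triangle, meeting each side would force [y] to lie on all three
     sides. *)
  - move=> x y xX yX exy; rewrite !inE; apply: contraT; rewrite !negb_or.
    move=> /andP[/andP[xa xb] xc].
    have y_in p q : p \in X -> q \in X -> e p q -> x != p -> x != q ->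
        y \in [set p; q].
      move=> pX qX epq xp xq; have [w [_]] := meetP p q x y pX qX xX yX epq exy.
      by rewrite in_set2 => wpq; rewrite !inE => /orP[]/eqP wE; subst w;
        rewrite // (negPf xp) (negPf xq) in wpq.
    have := y_in a b aX bX eab xa xb; have := y_in a c aX cX eac xa xc.
    have := y_in b c bX cX ebc xb xc; rewrite !inE.
    case/orP=> /eqP->; first by rewrite (eq_sym b) ab bc.
    by rewrite !(eq_sym c) ac bc.
  exists [set a; b; c], A, (~: [set a; b; c]); split=> //.
    by constructor 4; exists a, b, c; rewrite eab ebc eac.
  (* Two sides through [p] share only [p], so [p] avoids [Y]. *)
  have notY p q r : p \in X -> q \in X -> r \in X -> e p q -> e p r -> q != r ->
      p \notin Y.
    move=> pX qX rX epq epr qr; have [w [wY]] := meetP p q p r pX qX pX rX epq epr.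
    rewrite !inE => /orP[/eqP<- //|/eqP wq] /orP[/eqP<- //|/eqP wr].
    by rewrite -wq wr eqxx in qr.
  apply/subsetP => y yY; rewrite !inE -orbA; apply/negP.
  case/or3P=> /eqP yE; move: yY; rewrite yE; apply/negP.
  - by apply: (notY a b c); rewrite ?bc.
  - by apply: (notY b a c); rewrite ?ac // e_sym.
  - by apply: (notY c a b); rewrite ?ab // e_sym.
have {}notri a b c :
    a \in X -> b \in X -> c \in X -> e a b -> e b c -> ~~ e a c.
  move=> aX bX cX eab ebc; apply: contra notri => eac.
  by apply/existsP; exists (a, b, c); rewrite /= aX bX cX eab ebc.
have [indX|/forall_inPn[u uX /forall_inPn[v vX /negPn euv]]] :=
  boolP (independent e X).
  have [A maxA XA] := max_indep_ext (subsetT X) indX.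
  exists set0, A, setT; split; rewrite ?set0U //.
  by constructor 1.
have [b [bX bY [a aX eba] center]] :=
  edges_meet_center meet notri uX vX euv.
(* The star consists of [b] and its neighbours in [X], which are independent as [X] contains no
   triangle. *)
have [||A maxA XA] := @max_indep_cover X (b |: [set x in X | e b x]).
- by apply/subsetP => x; rewrite !inE => /orP[/eqP->|/andP[]].
- move=> x y xX yX exy; have := center x y xX yX exy; rewrite !inE xX.
  by case/orP=> /eqP->; rewrite ?eqxx // e_sym exy orbT.
exists (b |: [set x in X | e b x]), A, (~: [set b]); split=> //.
  constructor 3; exists b; split=> //; exists [set x in X | e b x]; split=> //.
  - by apply/set0Pn; exists a; rewrite inE aX.
  - by rewrite inE e_irr andbF.
  - by move=> x; rewrite inE edge_setE // e_sym => /andP[].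
  - apply/independentP => x y; rewrite !inE => /andP[xX ebx] /andP[yX eby].
    by apply: contraL eby; apply: notri.
by apply/subsetP => y yY; rewrite !inE; apply: contraTneq yY => ->.
Qed.

End Facets.

(** * Facets as maximal listed sets, and edges of the complex *)

Lemma facet_exists (X : finType) (P : pred {set X}) s :
  P s -> exists2 t, maximal P t & s \subset t.
Proof.
move=> Ps; have [t /maxsetP[Pt max_t] st] := maxset_exists Ps.
by exists t => //; split.
Qed.

Theorem theorem2p2 (K : fieldType) (V : finType) (e : rel V)
    (e_sym : symmetric e) (e_irr : irreflexive e)
    (no_isolated : forall v : V, exists w : V, e v w) :
  (forall F : {set V * 'I_2},
      facet (Gamma2 K e) F <-> maximal (listed_form e) F) /\
  (forall a b : V, [set a; b] \in edge_set e ->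
      copy1 [set a; b] = [set (a, ord0); (b, ord0)] /\
      complex_edge (Gamma2 K e) (copy1 [set a; b])).
Proof.
pose face s := edges_meet e (layer ord0 s) (layer ord_max s).
have faceE s : Gamma2 K e s <-> face s by apply: Gamma2E.
have type_face W A Z : facet_type e W A Z -> face (listed_set W A Z).
  move=> WAZ; have := edges_meet_facet_type e_sym e_irr WAZ.
  have := subxx (listed_set W A Z); rewrite sub_listed_set.
  by move=> /andP[sX sY]; apply: edges_meet_sub sX sY.
have face_type s : face s ->
    exists W A Z, facet_type e W A Z /\ s \subset listed_set W A Z.
  move=> /(edges_meet_sub_facet_type e_sym e_irr)[W [A [Z [WAZ sX sY]]]].
  by exists W, A, Z; rewrite sub_listed_set sX sY.
have listed_face s : listed_form e s -> face s.
  by move=> [W [A [Z [[WAZ _] ->]]]]; apply: type_face.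
have facet_listed s : maximal face s -> listed_form e s.
  move=> [fs max_s]; have [W [A [Z [WAZ sub]]]] := face_type s fs.
  have sE := max_s _ (type_face _ _ _ WAZ) sub.
  (* A larger [W'] gives a face containing the facet [s], hence [s] itself; so [W'] lies in the
     union of [W] and [A], and it is disjoint from [A]. *)
  exists W, A, Z; split=> //; split=> // W' WAZ' WW'.
  have W'E : listed_set W' A Z = s.
    apply: max_s; first exact: type_face.
    by apply: subset_trans sub _; rewrite setSU // setSU // imsetS.
  apply/eqP; rewrite eqEsubset WW' andbT; apply/subsetP => v vW'.
  have : (v, ord0) \in listed_set W A Z by rewrite sE -W'E in_listed_set0 vW'.
  rewrite in_listed_set0.
  by rewrite (negPf (facet_type_disjoint e_sym e_irr WAZ' vW')) orbF.
split=> [F|a b].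
  have facetE : facet (Gamma2 K e) F <-> maximal face F.
    by split=> -[/faceE fF max_F]; split=> // t /faceE; apply: max_F.
  split=> [/facetE FF|[lF max_F]].
    split=> [|t /listed_face]; first exact: facet_listed.
    exact: FF.2.
  apply/facetE.
  (* A maximal listed set lies in some facet; that facet is listed too, so the two agree. *)
  have [t [ft max_t] Ft] := facet_exists (listed_face F lF).
  by rewrite -(max_F t (facet_listed t (conj ft max_t)) Ft).
rewrite edge_setE // => eab; have ab := edge_neq e_irr eab.
have copyE : copy1 [set a; b] = [set (a, ord0); (b, ord0)].
  by rewrite /copy1 imsetU1 imset_set1.
split=> //; rewrite /complex_edge copyE cards2 xpair_eqE negb_and ab.
split=> //; apply/faceE/edges_meetP => x y z t.
rewrite !inE !xpair_eqE !andbT => xab yab zab tab exy ezt.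
(* The second layer is empty, so [a] avoids it, and [a] lies on every edge inside [{a, b}]. *)
have a_end p q : (p == a) || (p == b) -> (q == a) || (q == b) -> e p q ->
    a \in [set p; q].
  rewrite !inE !(eq_sym a); case: eqP => //= _ /eqP->.
  by case: eqP => //= _ /eqP->; rewrite e_irr.
by exists a; split; [rewrite !inE !xpair_eqE !andbF|apply: a_end|apply: a_end].
Qed.
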